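(* Let $t\ge2$ be an integer and let $(m,k)$ be an admissible parameter. Starting from $(m,k)$ and repeatedly replacing every parameter with denominator at least $2$ by its two Farey parents (a descent in the Stern–Brocot tree), the procedure terminates after finitely many steps, and all leaves of the resulting binary decomposition tree are seeds $(0,1)$ or $(1,1)$. The two seeds both have lower word $(0,1)$, so their prototiles are one and the same unit rhombus (degenerate for $t=2$), and their cores are a single unit edge of direction angle $0$. Reading the recursion upward, every prototile of the family is obtained from one unit edge by iterated fan-twist splicing: at every internal node of the decomposition tree, the core of the parameter at that node is the fan-twist splice of the cores of its two Farey parents, and the lower path of $(m,k)$ is its core followed by the terminal edge. Moreover, the leaves of the decomposition tree of $(m,k)$, read from left to right with $(0,1)\mapsto0$ and $(1,1)\mapsto1$, spell the carry word $c(m,k)$.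
   Context: An admissible parameter is a pair of integers $(m,k)$ that either satisfies $0<m<k$ and $\gcd(m,k)=1$, or is one of the two formal seeds $(0,1)$, $(1,1)$. For admissible $(m,k)$ with $k\ge2$ the Farey parents are the pair $(m_1,k_1),(m_2,k_2)$ with $k_1=m^{-1}\bmod k\in\{1,\dots,k-1\}$, $m_1=(mk_1-1)/k$, $(m_2,k_2)=(m-m_1,k-k_1)$; these are admissible, with $m_2k_1-m_1k_2=1$. The decomposition tree of $(m,k)$ is the rooted binary tree with root $(m,k)$ in which a node with denominator $\ge2$ has as left child its first Farey parent $(m_1,k_1)$ and as right child its second Farey parent $(m_2,k_2)$, and nodes with denominator $1$ are leaves. Fix $t\ge2$. For admissible $(m,k)$ put $n=tk$, $v_n(d)=(\cos\frac{2\pi d}{n},\sin\frac{2\pi d}{n})$, $s_j=jm\bmod k\in\{0,\dots,k-1\}$ for $0\le j\le k-1$. The lower word is $(s_0,\dots,s_{k-1},k)$ and the lower path is the polygonal path starting at the origin and appending the unit edges $v_n(d)$ for $d$ running through the lower word. Its first $k$ edges form the core; its last edge, of direction angle $2\pi/t$, is the terminal edge. The upper path is built in the same way from the lower word with first and last entries exchanged; the prototile of $(m,k)$ is the closed polygon bounded by the lower and upper paths. Fan-twist splice of cores: for parameters $(m_1,k_1),(m_2,k_2)$, with $n=t(k_1+k_2)$, concatenate from the origin the core edges $j=0,\dots,k_1-1$ of $(m_1,k_1)$, edge $j$ rotated by $+j\cdot\frac{2\pi}{k_1n}$, followed by the core edges $i=0,\dots,k_2-1$ of $(m_2,k_2)$,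 edge $i$ rotated by $+\frac{2\pi}{n}-i\cdot\frac{2\pi}{k_2n}$. The carry word of $(m,k)$ is $c(m,k)=(c_0,\dots,c_{k-1})$ with $c_j=\lfloor (j+1)m/k\rfloor-\lfloor jm/k\rfloor\in\{0,1\}$. *)

(* Defs.v *)
From HB Require Import structures.
From mathcomp Require Import all_boot all_order all_algebra.
From mathcomp Require Import all_classical all_reals all_analysis.
Import Order.TTheory GRing.Theory Num.Theory numFieldNormedType.Exports.

Set Implicit Arguments.
Unset Strict Implicit.
Unset Printing Implicit Defensive.

Local Open Scope classical_set_scope.
Local Open Scope ring_scope.

(* A parameter (m, k).  Admissible parameters have nonnegative entries, so     *)
(* natural numbers lose nothing.                                              *)
Definition param : Type := (nat * nat)%type.

Definition is_seed (p : param) : bool :=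
  (p == (0, 1)%N) || (p == (1, 1)%N).

Definition admissible (p : param) : bool :=
  ((0 < p.1 < p.2)%N && coprime p.1 p.2) || is_seed p.

(* Only meaningful for k >= 2: 'Z_0 and 'Z_1 are both Z/2Z.                    *)
Definition inv_mod (m k : nat) : nat := ((m%:R : 'Z_k)^-1 : 'Z_k).

Definition parent1 (p : param) : param :=
  let k1 := inv_mod p.1 p.2 in (((p.1 * k1 - 1) %/ p.2)%N, k1).

Definition parent2 (p : param) : param :=
  ((p.1 - (parent1 p).1)%N, (p.2 - (parent1 p).2)%N).

Definition replace_by_parents (s : seq param) : seq param :=
  flatten [seq if (2 <= q.2)%N then [:: parent1 q; parent2 q] else [:: q]
          | q <- s].

Inductive tree : Type :=
| Leaf of param
| Node of param & tree & tree.

Inductive decomposition_tree : param -> tree -> Prop :=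
| decomposition_leaf p :
    p.2 = 1%N -> decomposition_tree p (Leaf p)
| decomposition_node p l r :
    (2 <= p.2)%N ->
    decomposition_tree (parent1 p) l ->
    decomposition_tree (parent2 p) r ->
    decomposition_tree p (Node p l r).

Definition label (T : tree) : param :=
  match T with Leaf q => q | Node q _ _ => q end.

Fixpoint leaves (T : tree) : seq param :=
  match T with Leaf q => [:: q] | Node _ l r => leaves l ++ leaves r end.

Fixpoint internal_nodes (T : tree) : seq param :=
  match T with
  | Leaf _ => [::]
  | Node q l r => q :: internal_nodes l ++ internal_nodes r
  end.

Definition seed_digit (p : param) : nat := if p == (0, 1)%N then 0%N else 1%N.

Definition carry_word (p : param) : seq nat :=
  mkseq (fun j => ((j.+1 * p.1) %/ p.2 - (j * p.1) %/ p.2)%N) p.2.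

Definition lower_word (p : param) : seq nat :=
  rcons (mkseq (fun j => ((j * p.1) %% p.2)%N) p.2) p.2.

Definition swap_ends (A : Type) (s : seq A) : seq A :=
  if s is [:: x, y & s'] then last y s' :: rcons (belast y s') x else s.

Definition upper_word (p : param) : seq nat := swap_ends (lower_word p).

Definition unit_edge (R : realType) (theta : R) : R * R :=
  (cos theta, sin theta).

Definition vdir (R : realType) (n d : nat) : R * R :=
  unit_edge (2 * pi * d%:R / n%:R).

Definition rotate (R : realType) (theta : R) (z : R * R) : R * R :=
  (z.1 * cos theta - z.2 * sin theta, z.1 * sin theta + z.2 * cos theta).

(* A polygonal path starting at the origin is given by its sequence of edge    *)
(* vectors.                                                                   *)
Definition lower_path (R : realType) (t : nat) (p : param) : seq (R * R) :=
  map (vdir R (t * p.2)) (lower_word p).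

Definition upper_path (R : realType) (t : nat) (p : param) : seq (R * R) :=
  map (vdir R (t * p.2)) (upper_word p).

Definition core (R : realType) (t : nat) (p : param) : seq (R * R) :=
  take p.2 (lower_path R t p).

Definition fan_twist (R : realType) (t k1 k2 : nat) (e1 e2 : seq (R * R)) :
    seq (R * R) :=
  let n := (t * (k1 + k2))%N in
  mkseq (fun j => rotate (j%:R * (2 * pi / (k1 * n)%:R)) (nth 0 e1 j)) k1 ++
  mkseq (fun i => rotate (2 * pi / n%:R - i%:R * (2 * pi / (k2 * n)%:R))
                         (nth 0 e2 i)) k2.

Definition fan_twist_splice (R : realType) (t : nat) (p1 p2 : param) :
    seq (R * R) :=
  fan_twist t p1.2 p2.2 (core R t p1) (core R t p2).

(* Bottom-up evaluation of a tree: every leaf contributes the same unit edge,  *)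
(* whatever its label.                                                        *)
Fixpoint iterated_splice (R : realType) (t : nat) (T : tree) : seq (R * R) :=
  match T with
  | Leaf _ => [:: unit_edge 0]
  | Node _ l r => fan_twist t (label l).2 (label r).2
                    (iterated_splice R t l) (iterated_splice R t r)
  end.

Definition vertex (R : realType) (E : seq (R * R)) (i : nat) : R * R :=
  \sum_(j < i) nth 0 E j.

Definition polyline (R : realType) (E : seq (R * R)) : set (R * R) :=
  [set z | exists i (x : R), [/\ (i < size E)%N, 0 <= x <= 1 &
     z = vertex E i + (x * (nth 0 E i).1, x * (nth 0 E i).2)]].

(* The compact region bounded by C: C together with the points that no        *)
(* connected set avoiding C joins to infinity.  (For z in C the condition is   *)
(* vacuous.)                                                                  *)
Definition region_bounded_by (R : realType) (C : set (R * R)) : set (R * R) :=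
  [set z | forall A : set (R * R),
     connected A -> A z -> A `&` C = set0 -> bounded_set A].

Definition closed_polygon (R : realType) (lower upper : seq (R * R)) :
    set (R * R) :=
  region_bounded_by (polyline lower `|` polyline upper).

Definition prototile (R : realType) (t : nat) (p : param) : set (R * R) :=
  closed_polygon (lower_path R t p) (upper_path R t p).
Arguments prototile : clear implicits.

(* Euclidean length; the library norm on R * R is the maximum norm.           *)
Definition euclid_norm (R : realType) (z : R * R) : R :=
  Num.sqrt (z.1 ^+ 2 + z.2 ^+ 2).

(* The sides u and w may be parallel, so degenerate rhombi are included.       *)
Definition unit_rhombus (R : realType) (S : set (R * R)) : Prop :=
  exists a u w : R * R, [/\ euclid_norm u = 1, euclid_norm w = 1 &
    S = [set z | exists x y : R, [/\ 0 <= x <= 1, 0 <= y <= 1 &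
          z = a + (x * u.1 + y * w.1, x * u.2 + y * w.2)]]].

Definition degenerate (R : realType) (S : set (R * R)) : Prop :=
  exists a b c : R, (a, b) != 0 /\ forall z, S z -> a * z.1 + b * z.2 = c.

(* Main.v *)
Require Import Defs.
From HB Require Import structures.
From mathcomp Require Import all_boot all_order all_algebra.
From mathcomp Require Import all_classical all_reals all_analysis.
From mathcomp Require Import zify ring lra.
Import Order.TTheory GRing.Theory Num.Theory numFieldNormedType.Exports.

Set Implicit Arguments.
Unset Strict Implicit.
Unset Printing Implicit Defensive.

Local Open Scope classical_set_scope.
Local Open Scope ring_scope.

(** If p has Farey parents p1 and p2, write m = m1 + m2 and k = k1 + k2 with
    m2 k1 - m1 k2 = 1.  Then m/k lies between m1/k1 and m2/k2, at distance
    1/(k k1) from the former and 1/(k k2) from the latter, so that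
      j m / k = j m1 / k1 + j / (k k1)                      for j <= k1,
      (k1 + i) m / k = m1 + i m2 / k2 + (k2 - i) / (k k2)   for i <= k2.
    The numerators j and k2 - i are less than k, so each correction is less
    than 1/k1 (respectively 1/k2), the gap between consecutive fractions of
    that denominator, and no integer is crossed ([divn_modn_perturb]).  Two
    facts follow.  The floors agree, so the carry word of p is the
    concatenation of the carry words of its parents ([carry_word_cat]).  The
    fractional parts differ by exactly the correction, and since an edge of the
    core has direction 2 pi / t times such a fractional part, the correction
    becomes the fan-twist rotation ([core_splice]).

    Parents of an admissible parameter are admissible with smaller
    denominators, so the descent stops, and it can only stop at seeds; every
    remaining combinatorial claim is an induction on the decomposition tree
    ([admissible_tree_ind]).

    For a seed, the lower and upper paths run along the sides of the rhombus
    spanned by (1, 0) and (cos theta, sin theta), theta = 2 pi / t, and the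
    region they bound is that rhombus.  A point outside a closed half-plane
    containing a curve escapes to infinity along a ray avoiding the curve, so
    the region lies in every such half-plane, and the rhombus is an
    intersection of half-planes ([region_sub_halfplane]).  Conversely the
    interior of the rhombus is open, and off the sides it is also closed, so it traps
    every connected set that meets it ([region_of_enclosed]).  For t = 2 there
    is no interior: the sides already cover the flat rhombus. *)

(** * Floors and remainders at a mediant *)

(** As rationals, [a / b = a1 / b1 + e / (b * b1)].  The perturbation is less than
    [1 / b1], while the fractional part of [a1 / b1] is at most [1 - 1 / b1]. *)
Lemma divn_modn_perturb (a b a1 b1 e : nat) :
  (0 < b1)%N -> (e < b)%N -> (b1 * a = b * a1 + e)%N ->
  (a %/ b = a1 %/ b1)%N /\ (b1 * (a %% b) = b * (a1 %% b1) + e)%N.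
Proof.
move=> b1_gt0 lt_e_b def_a.
have b_gt0 : (0 < b)%N by exact: leq_ltn_trans lt_e_b.
have def_a1 := divn_eq a1 b1.
have lt_r_b1 := ltn_pmod a1 b1_gt0.
set q := (a1 %/ b1)%N in def_a1 *; set r := (a1 %% b1)%N in def_a1 lt_r_b1 *.
have le_qb_a : (q * b <= a)%N by rewrite -(leq_pmul2l b1_gt0); nia.
have [d def_d] : exists d, a = (q * b + d)%N by exists (a - q * b)%N; lia.
have b1d : (b1 * d = b * r + e)%N by nia.
have lt_d_b : (d < b)%N by rewrite -(ltn_pmul2l b1_gt0); nia.
by rewrite def_d divnMDl // modnMDl divn_small // modn_small // addn0.
Qed.

Section Splice.
Variables m1 k1 m2 k2 : nat.
Hypothesis k1_gt0 : (0 < k1)%N.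
Hypothesis k2_gt0 : (0 < k2)%N.
Hypothesis det1 : (m2 * k1 = m1 * k2 + 1)%N.

(** The bound includes [j = k1], the right end of the last carry of the first
    parent. *)
Lemma mediant_divn_modn_left j : (j <= k1)%N ->
  ((j * (m1 + m2)) %/ (k1 + k2) = (j * m1) %/ k1)%N /\
  (k1 * ((j * (m1 + m2)) %% (k1 + k2)) =
     (k1 + k2) * ((j * m1) %% k1) + j)%N.
Proof. by move=> le_j_k1; apply: divn_modn_perturb => //; [lia|nia]. Qed.

(** The remainder starts [k2 / (k * k2)] above that of [m2 / k2] and loses
    [1 / (k * k2)] per step, which is the backward twist of the second fan. *)
Lemma mediant_divn_modn_right i : (i <= k2)%N ->
  (((k1 + i) * (m1 + m2)) %/ (k1 + k2) = m1 + (i * m2) %/ k2)%N /\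
  (k2 * (((k1 + i) * (m1 + m2)) %% (k1 + k2)) =
     (k1 + k2) * ((i * m2) %% k2) + (k2 - i))%N.
Proof.
move=> le_i_k2; rewrite -divnMDl // -(modnMDl m1 (i * m2) k2).
apply: divn_modn_perturb => //; [lia|].
(* The difference of the two sides is [k2 - i] times the determinant relation. *)
have det_k2 : (k2 * (m2 * k1) = k2 * (m1 * k2 + 1))%N by rewrite det1.
have det_i : (i * (m2 * k1) = i * (m1 * k2 + 1))%N by rewrite det1.
nia.
Qed.
End Splice.

(** * Farey parents *)

(** What the splicing arguments use of the parents: they hold for any two
    Farey neighbours, whatever modular inverse produced them. *)
Record farey_parents (p p1 p2 : param) : Prop := FareyParents {
  farey_den1 : (0 < p1.2)%N;
  farey_den2 : (0 < p2.2)%N;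
  farey_mediant : p = (p1.1 + p2.1, p1.2 + p2.2)%N;
  farey_det : (p2.1 * p1.2 = p1.1 * p2.2 + 1)%N }.

Lemma inv_modP m k : (1 < k)%N -> coprime m k ->
  (0 < inv_mod m k < k)%N /\ (m * inv_mod m k = 1 %[mod k])%N.
Proof.
move=> k_gt1 co_mk; have unit_m : (m%:R : 'Z_k) \is a GRing.unit.
  by rewrite unitZpE // coprime_sym.
have inv_lt : (inv_mod m k < k)%N.
  by rewrite /inv_mod -[X in (_ < X)%N](@Zp_cast k k_gt1) ltn_ord.
have mul1 : (m * inv_mod m k = 1 %[mod k])%N.
  rewrite -!(@val_Zp_nat k k_gt1) natrM [(inv_mod m k)%:R]natr_Zp.
  by rewrite mulrV.
split=> //; rewrite inv_lt andbT lt0n; apply/eqP => inv0.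
by move: mul1; rewrite inv0 muln0 mod0n modn_small.
Qed.

Lemma parents_farey p : (1 < p.2)%N -> admissible p ->
  farey_parents p (parent1 p) (parent2 p).
Proof.
case: p => m k /= k_gt1; rewrite /admissible /is_seed /= => adm.
have {adm} [/andP[m_gt0 lt_m_k] co_mk] : (0 < m < k)%N /\ coprime m k.
  case/orP: adm => [/andP[]//|/orP[]/eqP[_ k1]]; by rewrite k1 in k_gt1.
have [/andP[inv_gt0 inv_lt] mul1] := inv_modP k_gt1 co_mk.
rewrite /parent2 /parent1 /=; set k1 := inv_mod m k in inv_gt0 inv_lt mul1 *.
have [m1 def_m1] : exists m1, (m * k1 = m1 * k + 1)%N.
  exists (m * k1 %/ k)%N; rewrite {1}(divn_eq (m * k1) k) mul1.
  by rewrite (modn_small k_gt1).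
have -> : ((m * k1 - 1) %/ k)%N = m1 by rewrite def_m1 addnK mulnK // ltnW.
have le_m1_m : (m1 <= m)%N by nia.
split=> /=; [by []|by rewrite subn_gt0| |].
  by rewrite !subnKC // ltnW.
have [m2 def_m] : exists m2, m = (m1 + m2)%N by exists (m - m1)%N; lia.
have [k2 def_k] : exists k2, k = (k1 + k2)%N by exists (k - k1)%N; lia.
by move: def_m1; rewrite def_m def_k !addKn; nia.
Qed.

(** A common divisor of the entries of either parent divides both terms of
    [m2 * k1 = m1 * k2 + 1], hence is 1.  The seeds appear as the boundary cases:
    [m1 = 0] forces [k1 = 1], and [m2 >= k2] forces [m2 = k2 = 1]. *)
Lemma parents_admissible p : (1 < p.2)%N -> admissible p ->
  admissible (parent1 p) /\ admissible (parent2 p).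
Proof.
move=> k_gt1 adm; have := parents_farey k_gt1 adm; move: adm k_gt1.
case: (parent1 p) (parent2 p) => [m1 k1] [m2 k2] adm k_gt1.
case=> /= k1_gt0 k2_gt0 def_p det1; move: adm k_gt1; rewrite {}def_p.
rewrite /admissible /is_seed /= !xpair_eqE => adm k_gt1.
have lt_m_k : (0 < m1 + m2 < k1 + k2)%N by lia.
have bezout d : (d %| m1 * k2 -> d %| m2 * k1 -> d = 1)%N.
  by move=> d1; rewrite det1 (dvdn_addr _ d1) dvdn1 => /eqP.
split.
  have co1 : coprime m1 k1.
    apply/eqP/bezout; first exact/dvdn_mulr/dvdn_gcdl.
    exact/dvdn_mull/dvdn_gcdr.
  rewrite co1 andbT; case: (posnP m1) => [m1_0|m1_gt0]; last first.
    by apply/orP; left; nia.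
  by move: det1; rewrite m1_0 => /eqP; rewrite mul0n muln_eq1 => /andP[_ /eqP->].
have co2 : coprime m2 k2.
  apply/eqP/bezout; first exact/dvdn_mull/dvdn_gcdr.
  exact/dvdn_mulr/dvdn_gcdl.
rewrite co2 andbT; have m2_gt0 : (0 < m2)%N by lia.
rewrite m2_gt0 /=.
have [//|le_k2_m2] := ltnP m2 k2.
have : (k2 = 1)%N /\ (m2 = 1)%N by nia.
by case=> -> ->.
Qed.

(** * Decomposition trees *)

Lemma admissible_den1 p : admissible p -> p.2 = 1%N -> is_seed p.
Proof. by case: p => [m k] /= + k1; rewrite /admissible /= k1; lia. Qed.

Lemma admissible_den_gt0 p : admissible p -> (0 < p.2)%N.
Proof.
by case: p => [m k]; rewrite /admissible /is_seed !xpair_eqE /=; lia.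
Qed.

Lemma decomposition_tree_exists p :
  admissible p -> exists T, decomposition_tree p T.
Proof.
have [n] := ubnP p.2; elim: n p => // n IHn p le_k_n adm_p.
have k_gt0 := admissible_den_gt0 adm_p.
have [k_gt1|k_le1] := ltnP 1 p.2; last first.
  by exists (Leaf p); apply: decomposition_leaf; lia.
have [adm1 adm2] := parents_admissible k_gt1 adm_p.
have [k1_gt0 k2_gt0 def_p _] := parents_farey k_gt1 adm_p.
have def_k : p.2 = ((parent1 p).2 + (parent2 p).2)%N by rewrite {1}def_p.
have [|l Tl] := IHn (parent1 p) _ adm1; first lia.
have [|r Tr] := IHn (parent2 p) _ adm2; first lia.
by exists (Node p l r); apply: decomposition_node.
Qed.

Lemma decomposition_tree_unique p T T' :
  decomposition_tree p T -> decomposition_tree p T' -> T' = T.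
Proof.
move=> DT; elim: DT T' => {p T} [p k1|p l r k_gt1 _ IHl _ IHr] T' DT'.
  by case: DT' k1 => // q l r k_gt1 _ _ k1; rewrite k1 in k_gt1.
case: DT' k_gt1 IHl IHr => [q k1|q l' r' _ Dl Dr] k_gt1 IHl IHr.
  by rewrite k1 in k_gt1.
by rewrite (IHl _ Dl) (IHr _ Dr).
Qed.

Lemma label_decomposition p T : decomposition_tree p T -> label T = p.
Proof. by case. Qed.

(** Induction on a decomposition tree that carries along admissibility and the
    Farey relations of every node. *)
Lemma admissible_tree_ind (P : param -> tree -> Prop) :
  (forall p, is_seed p -> P p (Leaf p)) ->
  (forall p l r, (1 < p.2)%N -> admissible p ->
     farey_parents p (parent1 p) (parent2 p) ->
     label l = parent1 p -> label r = parent2 p ->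
     P (parent1 p) l -> P (parent2 p) r -> P p (Node p l r)) ->
  forall p T, admissible p -> decomposition_tree p T -> P p T.
Proof.
move=> Pleaf Pnode p T + DT.
elim: DT => {p T} [p k1|p l r k_gt1 Dl IHl Dr IHr] adm_p.
  exact/Pleaf/admissible_den1.
have [adm1 adm2] := parents_admissible k_gt1 adm_p.
apply: Pnode => //; [exact: parents_farey|exact: label_decomposition..| |].
  exact: IHl.
exact: IHr.
Qed.

Lemma seed_den p : is_seed p -> p.2 = 1%N.
Proof. by case/orP => /eqP->. Qed.

Lemma leaves_seeds p T :
  admissible p -> decomposition_tree p T -> all is_seed (leaves T).
Proof.
move: p T; apply: admissible_tree_ind => [p /= ->//|p l r _ _ _ _ _].
by rewrite /= all_cat => -> ->.
Qed.

Lemma replace_by_parents_cat s1 s2 :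
  replace_by_parents (s1 ++ s2) = replace_by_parents s1 ++ replace_by_parents s2.
Proof. by rewrite /replace_by_parents map_cat flatten_cat. Qed.

Lemma iter_replace_cat N s1 s2 :
  iter N replace_by_parents (s1 ++ s2) =
  iter N replace_by_parents s1 ++ iter N replace_by_parents s2.
Proof. by elim: N => //= N ->; rewrite replace_by_parents_cat. Qed.

(** Seeds are fixed by the replacement, so the two subtrees, which may have
    different heights, can be run for a common number of steps: this is why
    the claim is made for all large [N]. *)
Lemma iter_replace_leaves p T : admissible p -> decomposition_tree p T ->
  exists N0, forall N, (N0 <= N)%N ->
    iter N replace_by_parents [:: p] = leaves T.
Proof.
move: p T; apply: admissible_tree_ind => [p seed_p|p l r k_gt1 _ _ _ _].
  exists 0%N => N _; elim: N => //= N ->.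
  by rewrite /replace_by_parents /= (seed_den seed_p).
move=> [Nl IHl] [Nr IHr]; exists (maxn Nl Nr).+1 => -[//|N].
rewrite ltnS geq_max => /andP[leNl leNr].
rewrite iterSr {2}/replace_by_parents /= k_gt1 cats0.
by rewrite -cat1s iter_replace_cat IHl // IHr.
Qed.

Lemma internal_node_admissible p T : admissible p -> decomposition_tree p T ->
  forall q, q \in internal_nodes T -> admissible q && (1 < q.2)%N.
Proof.
move: p T; apply: admissible_tree_ind => //=.
move=> p l r k_gt1 adm_p _ _ _ IHl IHr q.
rewrite inE mem_cat => /or3P[/eqP->||]; [by rewrite adm_p|exact: IHl|exact: IHr].
Qed.

(** * Carry words *)

(** Carries are differences of consecutive floors, and the floors agree with those
    of the parents up to the constant [m1], which cancels. *)
Lemma carry_word_cat p p1 p2 : farey_parents p p1 p2 ->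
  carry_word p = carry_word p1 ++ carry_word p2.
Proof.
case: p1 p2 => [m1 k1] [m2 k2] [/= k1_gt0 k2_gt0 -> det1].
rewrite /carry_word /= /mkseq iotaD map_cat add0n; congr (_ ++ _).
  apply/eq_in_map => j; rewrite mem_iota => /andP[_ lt_j_k1].
  have [-> _] := mediant_divn_modn_left k1_gt0 k2_gt0 det1 (ltnW lt_j_k1).
  by have [-> _] := mediant_divn_modn_left k1_gt0 k2_gt0 det1 lt_j_k1.
rewrite -[in iota k1 k2](addn0 k1) iotaDl -map_comp.
apply/eq_in_map => i; rewrite mem_iota => /andP[_ lt_i_k2] /=.
rewrite -addnS.
have [-> _] := mediant_divn_modn_right k1_gt0 k2_gt0 det1 (ltnW lt_i_k2).
have [-> _] := mediant_divn_modn_right k1_gt0 k2_gt0 det1 lt_i_k2.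
by rewrite subnDl.
Qed.

Lemma leaves_carry_word p T : admissible p -> decomposition_tree p T ->
  map seed_digit (leaves T) = carry_word p.
Proof.
move: p T; apply: admissible_tree_ind => [p /orP[]/eqP->//|].
move=> p l r _ _ farey _ _ /=; rewrite map_cat => -> ->.
by rewrite (carry_word_cat farey).
Qed.

(** * Cores as fan-twist splices *)

Lemma rotate_unit_edge (R : realType) (theta phi : R) :
  rotate theta (unit_edge phi) = unit_edge (phi + theta).
Proof. by rewrite /rotate /unit_edge cosD sinD; congr pair; rewrite [LHS]addrC. Qed.

Lemma coreE (R : realType) t p :
  core R t p = mkseq (fun j => vdir R (t * p.2) ((j * p.1) %% p.2)) p.2.
Proof.
rewrite /core /lower_path /lower_word map_rcons -cats1 take_size_cat.
  by rewrite /mkseq -map_comp.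
by rewrite size_map size_mkseq.
Qed.

(** Edges are unit vectors, so only their angles are compared.  After division by
    [t], the angle identity is the remainder identity at the mediant. *)
Lemma core_splice (R : realType) t p p1 p2 : (0 < t)%N ->
  farey_parents p p1 p2 -> core R t p = fan_twist_splice R t p1 p2.
Proof.
case: p1 p2 => [m1 k1] [m2 k2] t_gt0 [/= k1_gt0 k2_gt0 -> det1].
rewrite /fan_twist_splice /fan_twist !coreE /= /mkseq iotaD map_cat add0n.
have t0 : (t%:R : R) != 0 by rewrite pnatr_eq0 -lt0n.
have k10 : (k1%:R : R) != 0 by rewrite pnatr_eq0 -lt0n.
have k20 : (k2%:R : R) != 0 by rewrite pnatr_eq0 -lt0n.
have k0 : (k1%:R + k2%:R : R) != 0 by rewrite -natrD pnatr_eq0 -lt0n ltn_addr.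
congr (_ ++ _).
  apply/eq_in_map => j; rewrite mem_iota => /andP[_ lt_j_k1].
  rewrite nth_mkseq // rotate_unit_edge; congr unit_edge.
  have [_] := mediant_divn_modn_left k1_gt0 k2_gt0 det1 (ltnW lt_j_k1).
  set s := (_ %% (k1 + k2))%N; set s1 := (_ %% k1)%N.
  move/(congr1 (fun x => x%:R : R)); rewrite natrD !natrM natrD => def_s.
  have {def_s} -> : s%:R = ((k1%:R + k2%:R) * s1%:R + j%:R) / k1%:R :> R.
    by rewrite -def_s mulrC mulKf.
  by field; rewrite ?k0 ?k10 ?t0.
rewrite -[in iota k1 k2](addn0 k1) iotaDl -map_comp.
apply/eq_in_map => i; rewrite mem_iota => /andP[_ lt_i_k2] /=.
rewrite nth_mkseq // rotate_unit_edge; congr unit_edge.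
have [_] := mediant_divn_modn_right k1_gt0 k2_gt0 det1 (ltnW lt_i_k2).
set s := (_ %% (k1 + k2))%N; set s2 := (_ %% k2)%N.
move/(congr1 (fun x => x%:R : R)).
rewrite natrD !natrM natrD natrB 1?ltnW // => def_s.
have {def_s} -> : s%:R = ((k1%:R + k2%:R) * s2%:R + (k2%:R - i%:R)) / k2%:R :> R.
  by rewrite -def_s mulrC mulKf.
by field; rewrite ?k0 ?k20 ?t0.
Qed.

Lemma core_seed (R : realType) t p : is_seed p -> core R t p = [:: unit_edge 0].
Proof.
case/orP => /eqP->; rewrite coreE /mkseq /= /vdir ?mod0n ?mul0n.
all: by rewrite mulr0n mulr0 mul0r.
Qed.

Lemma core_iterated_splice (R : realType) t p T : (0 < t)%N ->
  admissible p -> decomposition_tree p T -> core R t p = iterated_splice R t T.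
Proof.
move=> t_gt0; move: p T; apply: admissible_tree_ind => [p|].
  exact: core_seed.
move=> p l r _ _ farey /= -> -> <- <-.
exact: core_splice.
Qed.

Lemma lower_path_core (R : realType) t p : (0 < t)%N -> (0 < p.2)%N ->
  lower_path R t p = rcons (core R t p) (unit_edge (2 * pi / t%:R)).
Proof.
move=> t_gt0 k_gt0; rewrite coreE /lower_path /lower_word map_rcons.
congr rcons; first by rewrite /mkseq -map_comp.
rewrite /vdir natrM; congr unit_edge; field.
by rewrite !pnatr_eq0 -!lt0n t_gt0 k_gt0.
Qed.

Lemma map_swap_ends (A B : Type) (f : A -> B) s :
  map f (swap_ends s) = swap_ends (map f s).
Proof.
case: s => [|x [|y s]] //=.
by rewrite map_rcons last_map belast_map.
Qed.

Lemma upper_path_swap (R : realType) t p :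
  upper_path R t p = swap_ends (lower_path R t p).
Proof. exact: map_swap_ends. Qed.

(** * Regions bounded by curves *)

Section Region.
Variable R : realType.
Implicit Types (C : set (R * R)) (z : R * R).

(** A point beyond the half-plane is carried off to infinity by the ray along the
    outer normal [(a1, a2)], on which the linear form only grows. *)
Lemma region_sub_halfplane (a1 a2 b : R) C : (a1 != 0) || (a2 != 0) ->
  (forall z, C z -> a1 * z.1 + a2 * z.2 <= b) ->
  forall z, region_bounded_by C z -> a1 * z.1 + a2 * z.2 <= b.
Proof.
move=> a_neq0 C_le z /= reg_z; rewrite leNgt; apply/negP => lt_b_z.
have aa_gt0 : 0 < a1 ^+ 2 + a2 ^+ 2.
  by rewrite lt0r paddr_eq0 ?sqr_ge0 // !sqrf_eq0 negb_and a_neq0 addr_ge0 ?sqr_ge0.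
pose f (r : R) : R * R := (z.1 + r * a1, z.2 + r * a2).
have affine_cts (x a : R) : continuous (fun r : R => x + r * a : R).
  by move=> r; apply: cvgD; [exact: cvg_cst|apply: cvgMl; exact: cvg_id].
have cts_f : continuous f.
  by move=> r; exact: cvg_pair (affine_cts z.1 a1 r) (affine_cts z.2 a2 r).
have := reg_z (f @` [set r | 0 <= r]).
case.
- apply: connected_continuous_connected; last exact: continuous_subspaceT.
  apply/connected_intervalP => x y x_ge0 y_ge0 w /andP[le_xw _].
  exact: le_trans le_xw.
- by exists 0; rewrite /= ?lexx // /f !mul0r !addr0; case: (z).
- rewrite -subset0 => p [[r /= r_ge0 <-]] /C_le /=.
  have : 0 <= r * (a1 ^+ 2 + a2 ^+ 2) by rewrite mulr_ge0 // ltW.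
  by move: lt_b_z; clear; lra.
move=> M0 [_ bdM].
pose M := Num.max (M0 + 1) 0.
have ltM : M0 < M by rewrite lt_max ltrDl ltr01.
have M_ge0 : 0 <= M by rewrite le_max lexx orbT.
have {bdM} bd r : 0 <= r -> `|z.1 + r * a1| <= M /\ `|z.2 + r * a2| <= M.
  move=> r_ge0; have /(_ (f r)) := bdM _ ltM; rewrite /= prod_normE /=.
  by rewrite ge_max => /(_ (ex_intro2 _ _ r r_ge0 erefl))/andP[].
have unbd (x a : R) : a != 0 -> (forall r, 0 <= r -> `|x + r * a| <= M) -> False.
  move=> a0 /(_ ((M + `|x| + 1) / `|a|)).
  have a_gt0 : 0 < `|a| by rewrite normr_gt0.
  (* At [r = (M + |x| + 1) / |a|] the modulus is at least [M + 1]. *)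
  have num_ge0 : 0 <= M + `|x| + 1 by rewrite !addr_ge0.
  rewrite divr_ge0 // => /(_ isT); apply/negP; rewrite -ltNge.
  have := lerB_normD ((M + `|x| + 1) / `|a| * a) x.
  rewrite normrM normf_div normr_id divfK ?gt_eqF // (ger0_norm num_ge0).
  by rewrite [X in _ <= `|X|]addrC; lra.
case/orP: a_neq0 => /unbd; apply=> r /bd[]; eauto.
Qed.

(** [I] plays the interior and [S] the closed region.  A connected [A] avoiding [C]
    meets the open set [I] and the closed set [S] in the same part, so that
    part is clopen in [A]: once nonempty, it is all of [A]. *)
Lemma region_of_enclosed C I S : I `<=` S -> S `\` C `<=` I ->
  open I -> closed S -> bounded_set S -> S `<=` region_bounded_by C.
Proof.
move=> sub_IS sub_SI I_open S_closed S_bounded z Sz A A_conn Az AC0.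
have AS : A `&` S = A `&` I.
  apply/seteqP; split=> p [Ap]; last by move/sub_IS.
  move=> Sp; split=> //; apply: sub_SI; split=> // Cp.
  by rewrite -[False]/(set0 p) -AC0.
have A_S : A `&` S = A.
  apply: A_conn; [by exists z|by exists I|by exists S].
suff sub_AS : A `<=` S.
  case: S_bounded => M [M_real bdM]; exists M; split=> // N lt_MN p /sub_AS.
  exact: bdM.
by rewrite -A_S => p [].
Qed.

End Region.

(** * The rhombus of the seeds *)

Section Rhombus.
Variables (R : realType) (c s : R).

Definition rhombus_sides : set (R * R) :=
  polyline [:: (1, 0); (c, s)] `|` polyline [:: (c, s); (1, 0)].

Definition rhombus : set (R * R) :=
  [set z | exists x y : R, [/\ 0 <= x <= 1, 0 <= y <= 1 & z = (x + y * c, y * s)]].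

Lemma polyline2 (e1 e2 : R * R) : polyline [:: e1; e2] =
  [set z | exists2 x, 0 <= x <= 1 & z = (x * e1.1, x * e1.2)] `|`
  [set z | exists2 x, 0 <= x <= 1 & z = (e1.1 + x * e2.1, e1.2 + x * e2.2)].
Proof.
have v0 : vertex [:: e1; e2] 0 = 0 by rewrite /vertex big_ord0.
have v1 : vertex [:: e1; e2] 1 = e1 by rewrite /vertex big_ord1.
apply/seteqP; split=> z.
  case=> -[|[|i]] [x [//= _ x01 ->]]; [left|right]; exists x => //.
    by rewrite v0 add0r.
  by rewrite v1.
case=> [[x x01 ->]|[x x01 ->]]; [exists 0%N, x|exists 1%N, x]; split=> //=.
  by rewrite v0 add0r.
by rewrite v1.
Qed.

Lemma rhombus_sidesP z : rhombus_sides z <-> exists x y : R,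
  [/\ 0 <= x <= 1, 0 <= y <= 1, z = (x + y * c, y * s) &
      [|| x == 0, x == 1, y == 0 | y == 1]].
Proof.
rewrite /rhombus_sides !polyline2 /=; split.
  case=> -[] [x x01 ->] /=.
  - by exists x, 0; split; rewrite ?lexx ?ler01 ?eqxx ?orbT //; congr pair; ring.
  - by exists 1, x; split; rewrite ?lexx ?ler01 ?eqxx ?orbT //; congr pair; ring.
  - by exists 0, x; split; rewrite ?lexx ?ler01 ?eqxx ?orbT //; congr pair; ring.
  - by exists x, 1; split; rewrite ?lexx ?ler01 ?eqxx ?orbT //; congr pair; ring.
move=> [x [y [x01 y01 -> /or4P[]/eqP->]]].
- by right; left; exists y => //; congr pair; ring.
- by left; right; exists y => //; congr pair; ring.
- by left; left; exists x => //; congr pair; ring.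
- by right; right; exists x => //; congr pair; ring.
Qed.

Lemma rhombus_sides_sub : rhombus_sides `<=` rhombus.
Proof. by move=> z /rhombus_sidesP[x [y [x01 y01 -> _]]]; exists x, y. Qed.

(** When the sides are opposite, [x] and [y] matter only through [x - y], so one of
    them can be taken to be 0. *)
Lemma rhombus_flat : s = 0 -> c = - 1 -> rhombus_sides = rhombus.
Proof.
move=> s0 c1; apply/seteqP; split; first exact: rhombus_sides_sub.
move=> _ [x [y [x01 y01 ->]]]; apply/rhombus_sidesP; rewrite s0 c1.
have [le_yx|lt_xy] := lerP y x.
  exists (x - y), 0; split; rewrite ?lexx ?ler01 ?eqxx ?orbT //; first by lra.
  by congr pair; ring.
exists 0, (y - x); split; rewrite ?lexx ?ler01 ?eqxx ?orbT //; first by lra.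
by congr pair; ring.
Qed.

(** The two forms are [s] times the coordinates of [z] in the basis [(1, 0)],
    [(c, s)]; keeping the factor [s] avoids divisions. *)
Lemma rhombus_halfplanesP z : 0 < s -> rhombus z <->
  [/\ 0 <= z.2, z.2 <= s, 0 <= s * z.1 - c * z.2 & s * z.1 - c * z.2 <= s].
Proof.
move=> s_gt0; split=> [[x [y [x01 y01 ->]]] /=|[]].
  have -> : s * (x + y * c) - c * (y * s) = x * s by ring.
  by split; nra.
move=> z2_ge0 z2_le w_ge0 w_le.
exists ((s * z.1 - c * z.2) / s), (z.2 / s).
rewrite !divr_ge0 ?(ltW s_gt0) // !ler_pdivrMr // !mul1r z2_le w_le.
split=> //; case: z {z2_ge0 z2_le w_ge0 w_le} => z1 z2 /=.
by congr pair; field; rewrite gt_eqF.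
Qed.

Lemma rhombus_flatP z : s = 0 -> c = - 1 ->
  rhombus z <-> z.2 = 0 /\ -1 <= z.1 <= 1.
Proof.
move=> s0 c1; rewrite /rhombus /= s0 c1; split=> [[x [y [x01 y01 ->]]] /=|].
  by rewrite mulr0; split=> //; lra.
case: z => z1 z2 /= [-> z1_bd]; have [z1_ge0|z1_lt0] := lerP 0 z1.
  by exists z1, 0; rewrite !mul0r addr0; split=> //; lra.
by exists 0, (- z1); rewrite mulr0 mulrNN mulr1 add0r; split=> //; lra.
Qed.

(** The hypothesis covers directions [(c, s)] of angle strictly between 0 and pi,
    where four half-planes along the sides cut out the rhombus, and angle pi,
    where the line [z.2 = 0] enters as two opposite half-planes. *)
Lemma region_rhombus_sub : 0 < s \/ s = 0 /\ c = - 1 ->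
  region_bounded_by rhombus_sides `<=` rhombus.
Proof.
move=> s_cases z reg_z.
have halfplane a1 a2 b : (a1 != 0) || (a2 != 0) ->
    (forall z, rhombus z -> a1 * z.1 + a2 * z.2 <= b) ->
    a1 * z.1 + a2 * z.2 <= b.
  move=> a0 leb; apply: region_sub_halfplane reg_z => // p.
  by move=> /rhombus_sides_sub; exact: leb.
case: s_cases => [s_gt0|[s0 c1]].
  have s_neq0 : s != 0 by rewrite gt_eqF.
  have inP p := rhombus_halfplanesP p s_gt0.
  have h1 : 0 * z.1 + (-1) * z.2 <= 0.
    by apply: halfplane => [|p /inP[]]; [rewrite oppr_eq0 oner_eq0 orbT|lra].
  have h2 : 0 * z.1 + 1 * z.2 <= s.
    by apply: halfplane => [|p /inP[]]; [rewrite oner_eq0 orbT|lra].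
  have h3 : (- s) * z.1 + c * z.2 <= 0.
    by apply: halfplane => [|p /inP[]]; [rewrite oppr_eq0 s_neq0|lra].
  have h4 : s * z.1 + (- c) * z.2 <= s.
    by apply: halfplane => [|p /inP[]]; [rewrite s_neq0|lra].
  by apply/inP; split; lra.
have inP p := rhombus_flatP p s0 c1.
have h1 : 0 * z.1 + (-1) * z.2 <= 0.
  by apply: halfplane => [|p /inP[]]; [rewrite oppr_eq0 oner_eq0 orbT|lra].
have h2 : 0 * z.1 + 1 * z.2 <= 0.
  by apply: halfplane => [|p /inP[]]; [rewrite oner_eq0 orbT|lra].
have h3 : (- 1) * z.1 + 0 * z.2 <= 1.
  by apply: halfplane => [|p /inP[]]; [rewrite oppr_eq0 oner_eq0|lra].
have h4 : 1 * z.1 + 0 * z.2 <= 1.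
  by apply: halfplane => [|p /inP[]]; [rewrite oner_eq0|lra].
by apply/inP; split; lra.
Qed.

Lemma rhombus_bounded : bounded_set rhombus.
Proof.
exists (1 + `|c| + `|s|); split; first exact: num_real.
move=> M ltM _ [x [y [x01 y01 ->]]]; rewrite /= prod_normE /= ge_max.
have norm01 (w a : R) : 0 <= w <= 1 -> `|w * a| <= `|a|.
  by move=> /andP[w0 w1]; rewrite normrM ger0_norm // ler_piMl.
have := norm01 y c y01; have := norm01 y s y01; have := norm01 x 1 x01.
have := ler_normD x (y * c); rewrite mulr1 normr1.
by have := normr_ge0 s; have := normr_ge0 c; lra.
Qed.

Lemma rhombus_sub_region : 0 < s \/ s = 0 /\ c = - 1 ->
  rhombus `<=` region_bounded_by rhombus_sides.
Proof.
case=> [s_gt0|[s0 c1]]; last first.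
  rewrite (rhombus_flat s0 c1) => z Sz A _ Az AS0.
  by exfalso; rewrite -[False]/(set0 z) -AS0.
have inP z := rhombus_halfplanesP z s_gt0.
pose h (z : R * R) := s * z.1 - c * z.2.
have h_cts : continuous h.
  move=> z; apply: cvgB; apply: cvgMr; [exact: cvg_fst|exact: cvg_snd].
have snd_cts : continuous (@snd R R) by move=> z; exact: cvg_snd.
pose I : set (R * R) := snd @^-1` `]0, s[ `&` h @^-1` `]0, s[.
apply: (@region_of_enclosed _ _ I).
- move=> z [] /=; rewrite !in_itv /= => /andP[? ?] /andP[? ?].
  by apply/inP; split; apply: ltW.
- move=> _ [[x [y [x01 y01 ->]]] nCz].
  have : ~~ [|| x == 0, x == 1, y == 0 | y == 1].
    by apply/negP => side; apply/nCz/rhombus_sidesP; exists x, y.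
  rewrite !negb_or => /and4P[x0 x1 y0 y1].
  have x_in : 0 < x < 1 by rewrite !lt_neqAle x1 eq_sym x0.
  have y_in : 0 < y < 1 by rewrite !lt_neqAle y1 eq_sym y0.
  split; rewrite /= /h in_itv /=.
    by rewrite mulr_gt0 // ?(andP y_in).1 //; move: s_gt0 y_in; nra.
  have -> : s * (x + y * c) - c * (y * s) = x * s by ring.
  by rewrite mulr_gt0 //; move: s_gt0 x_in; nra.
- apply: openI; apply: open_comp => //; exact: itv_open.
- have -> : rhombus = snd @^-1` `[0, s] `&` h @^-1` `[0, s].
    apply/seteqP; split=> z.
      by move/inP => [? ? ? ?]; split; rewrite /= in_itv /=; apply/andP.
    by move=> [] /=; rewrite !in_itv /= => /andP[? ?] /andP[? ?]; apply/inP.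
  by apply: closedI; apply: closed_comp => //; exact: itv_closed.
- exact: rhombus_bounded.
Qed.

Lemma region_rhombus_sides : 0 < s \/ s = 0 /\ c = - 1 ->
  region_bounded_by rhombus_sides = rhombus.
Proof.
by move=> hs; apply/seteqP; split;
  [exact: region_rhombus_sub|exact: rhombus_sub_region].
Qed.

End Rhombus.

Lemma seed_angle (R : realType) t : (2 <= t)%N ->
  let theta : R := 2 * pi / t%:R in
  (t = 2%N /\ sin theta = 0 /\ cos theta = -1) \/ (t != 2%N /\ 0 < sin theta).
Proof.
move=> t_ge2 theta; have [t2|t_neq2] := eqVneq t 2%N.
  left; have -> : theta = pi by rewrite /theta t2 mulrAC divff ?mul1r // pnatr_eq0.
  by rewrite sinpi cospi.
right; split=> //; apply: sin_gt0_pi.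
have t_gt2 : (2 : R) < t%:R by rewrite ltr_nat ltn_neqAle eq_sym t_neq2.
have t_gt0 : (0 : R) < t%:R by exact: lt_trans t_gt2.
have pi_gt0 := pi_gt0 R.
rewrite /theta divr_gt0 ?mulr_gt0 //= ltr_pdivrMr // mulrC.
by rewrite ltr_pM2l.
Qed.

Lemma seed_lower_path (R : realType) t p : (0 < t)%N -> is_seed p ->
  lower_path R t p = [:: (1, 0); unit_edge (2 * pi / t%:R)].
Proof.
by move=> t_gt0 seed_p; rewrite lower_path_core ?core_seed ?seed_den //
  /unit_edge cos0 sin0.
Qed.

Lemma seed_prototile (R : realType) t p : (2 <= t)%N -> is_seed p ->
  prototile R t p = rhombus (cos (2 * pi / t%:R)) (sin (2 * pi / t%:R)).
Proof.
move=> t_ge2 seed_p.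
rewrite /prototile /closed_polygon upper_path_swap.
rewrite seed_lower_path ?(ltnW t_ge2) //=.
apply: region_rhombus_sides.
by have [[_ [-> ->]]|[_ ?]] := seed_angle R t_ge2; [right|left].
Qed.

Lemma unit_rhombus_rhombus (R : realType) (theta : R) :
  unit_rhombus (rhombus (cos theta) (sin theta)).
Proof.
exists 0, (1, 0), (cos theta, sin theta); split.
- by rewrite /euclid_norm /= expr1n expr0n addr0 sqrtr1.
- by rewrite /euclid_norm /= cos2Dsin2 sqrtr1.
apply/seteqP; split=> z /= [x [y [x01 y01 ->]]]; exists x, y; split=> //.
  by rewrite add0r; congr pair; ring.
by rewrite add0r; congr pair; ring.
Qed.

Lemma degenerate_rhombus (R : realType) (c s : R) :
  degenerate (rhombus c s) <-> s = 0.
Proof.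
split=> [[a [b [d [ab0 line]]]]|s0]; last first.
  exists 0, 1, 0; split; first by rewrite xpair_eqE oner_eq0 andbF.
  by move=> _ [x [y [_ _ ->]]] /=; rewrite s0; ring.
have pt (x y : R) : 0 <= x <= 1 -> 0 <= y <= 1 -> a * (x + y * c) + b * (y * s) = d.
  by move=> x01 y01; apply: (line (_, _)); exists x, y.
have i0 : 0 <= (0 : R) <= 1 by lra.
have i1 : 0 <= (1 : R) <= 1 by lra.
have o := pt 0 0 i0 i0; have e1 := pt 1 0 i1 i0; have e2 := pt 0 1 i0 i1.
have d0 : d = 0 by rewrite -o; ring.
have a0 : a = 0 by rewrite -d0 -e1; ring.
move: e2 ab0; rewrite d0 a0 mul0r add0r mul1r xpair_eqE eqxx /= => /eqP.
by rewrite mulf_eq0 => /orP[->//|/eqP].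
Qed.

(** * Iterated splicing *)

Theorem corollary5p3 (R : realType) (t m k : nat)
    (ht : (2 <= t)%N) (hp : admissible (m, k)) :
  exists T : tree,
    (decomposition_tree (m, k) T /\ forall T', decomposition_tree (m, k) T' -> T' = T) /\
    (exists N, iter N replace_by_parents [:: (m, k)] = leaves T) /\
    all is_seed (leaves T) /\
    (lower_word (0, 1)%N = [:: 0; 1]%N /\ lower_word (1, 1)%N = [:: 0; 1]%N) /\
    (prototile R t (0, 1)%N = prototile R t (1, 1)%N /\
     unit_rhombus (prototile R t (0, 1)%N) /\
     (degenerate (prototile R t (0, 1)%N) <-> t = 2%N)) /\
    (core R t (0, 1)%N = [:: unit_edge 0] /\
     core R t (1, 1)%N = [:: unit_edge 0]) /\
    (forall q, q \in internal_nodes T ->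
       core R t q = fan_twist_splice R t (parent1 q) (parent2 q)) /\
    core R t (m, k) = iterated_splice R t T /\
    lower_path R t (m, k) = rcons (core R t (m, k)) (unit_edge (2 * pi / t%:R)) /\
    (let E := rcons (iterated_splice R t T) (unit_edge (2 * pi / t%:R)) in
     prototile R t (m, k) = closed_polygon E (swap_ends E)) /\
    map seed_digit (leaves T) = carry_word (m, k).
Proof.
have t_gt0 : (0 < t)%N by exact: ltnW.
have k_gt0 := admissible_den_gt0 hp.
have [T DT] := decomposition_tree_exists hp.
have core_T := core_iterated_splice R t_gt0 hp DT.
have low_T := lower_path_core R t_gt0 k_gt0.
have [N0 iterN] := iter_replace_leaves hp DT.
exists T; split; first by split=> // T'; exact: decomposition_tree_unique.
split; first by exists N0; exact: iterN.
split; first exact: leaves_seeds DT.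
split; first by [].
split.
  rewrite !seed_prototile //; split=> //; split.
    exact: unit_rhombus_rhombus.
  rewrite degenerate_rhombus.
  have [[t2 [sin0 _]]|[/eqP t_neq2 sin_gt0]] := seed_angle R ht; first by split.
  by split=> [sin0|//]; rewrite sin0 ltxx in sin_gt0.
split; first by rewrite !core_seed.
split.
  move=> q /(internal_node_admissible hp DT)/andP[adm_q den_q].
  exact/core_splice/parents_farey.
split; first exact: core_T.
split; first exact: low_T.
split; last exact: leaves_carry_word.
by rewrite -core_T -low_T /= /prototile upper_path_swap.
Qed.
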